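(* Let $k,k_P,k_Q$ be integers with $k\ge 3$ and $1\le k_P<k_Q<k$. Let $a\in C_c^\infty(\mathbb R^3)$ be supported in $[-1,1]^3$ with $a(0,0,0)\neq 0$, and for $\lambda>0$ let $$T_\lambda f(x,y)=\int_{\mathbb R} e^{i\lambda \Phi(x,y,t)}\,a(x,y,t)\,f(t)\,dt,\qquad \Phi(x,y,t)=x^{k-k_P}t^{k_P}+y^{k-k_Q}t^{k_Q}.$$ Then there exist constants $c>0$ and $\lambda_1\ge 2$ such that, for all $\lambda\ge\lambda_1$, $$\|T_\lambda\|_{L^2(\mathbb R)\to L^2(\mathbb R^2)}\ge c\,\lambda^{-\rho_*},$$ where $\rho_*=\min\{\rho_1,\rho_2,\rho_3\}$ with $\rho_1,\rho_2,\rho_3$ as defined in the context.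
   Context: For integers $k\ge3$, $1\le k_P<k_Q<k$, define $$\rho_1=\frac1{2(k-k_P)}+\frac1{2(k-k_Q)},\qquad \rho_2=\frac1{2(k-k_P)}+\frac1{2k_Q}\Bigl(1-\frac{k_P}{k-k_P}\Bigr)=\frac{k_Q+k-2k_P}{2k_Q(k-k_P)},\qquad \rho_3=\frac1{2k_P}.$$ $\|\cdot\|_{L^2(\mathbb R)\to L^2(\mathbb R^2)}$ denotes the operator norm. The constants $c,\lambda_1$ are independent of $\lambda$ (they may depend on $k,k_P,k_Q$ and $a$). *)

(* Defs.v *)
From HB Require Import structures.
From mathcomp Require Import all_boot all_order all_algebra.
From mathcomp Require Export complex.
From mathcomp Require Import all_classical all_reals all_analysis.

Set Implicit Arguments.
Unset Strict Implicit.
Unset Printing Implicit Defensive.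

Import Order.TTheory GRing.Theory Num.Theory.
Import numFieldNormedType.Exports.

Local Open Scope classical_set_scope.
Local Open Scope ring_scope.
Local Open Scope complex_scope.

(** R^2 and R^3 are [R * R] and [R * R * R], so that the library's product
    topology and product measure apply. *)

Definition basis3 (R : realType) (i : 'I_3) : R * R * R :=
  ((i == 0%N :> nat)%:R, (i == 1%N :> nat)%:R, (i == 2%N :> nat)%:R).

Fixpoint iter_partial (R : realType) (s : seq 'I_3) (g : R * R * R -> R) :
    R * R * R -> R :=
  if s is i :: s' then fun p => 'D_(basis3 R i) (iter_partial s' g) p else g.

Definition smooth3 (R : realType) (g : R * R * R -> R) : Prop :=
  forall s : seq 'I_3, continuous (iter_partial s g) /\
    forall (i : 'I_3) (p : R * R * R), derivable (iter_partial s g) p (basis3 R i).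

Definition supp3 (R : realType) (a : R * R * R -> R[i]) : set (R * R * R) :=
  closure [set p | a p != 0].

Definition Cc_infty3 (R : realType) (a : R * R * R -> R[i]) : Prop :=
  [/\ smooth3 (fun p => complex.Re (a p)),
      smooth3 (fun p => complex.Im (a p)) &
      compact (supp3 a)].

Definition cube3 (R : realType) : set (R * R * R) :=
  (`[-1, 1] `*` `[-1, 1]) `*` `[-1, 1].

Definition expi (R : realType) (theta : R) : R[i] := cos theta +i* sin theta.

(** [R[i]] has no measurable structure or Bochner integral in the library, so
    measurability and integration go through real and imaginary parts.
    [Rintegral] is a total operator; in [T_op] below the integrand is integrable
    whenever [a] is in C_c^infty and [f] is in L^2. *)

Definition Cmeasurable_fun (R : realType) (d : measure_display)
    (X : measurableType d) (f : X -> R[i]) : Prop :=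
  measurable_fun setT (fun x => complex.Re (f x)) /\
  measurable_fun setT (fun x => complex.Im (f x)).

Definition Cintegral (R : realType) (d : measure_display)
    (X : measurableType d) (mu : {measure set X -> \bar R}) (f : X -> R[i]) :
    R[i] :=
  Rintegral mu setT (fun x => complex.Re (f x)) +i*
  Rintegral mu setT (fun x => complex.Im (f x)).

(** [normc] is the modulus as an element of [R]; the generic norm of [R[i]] takes
    its values in [R[i]]. *)
Definition L2norm (R : realType) (d : measure_display)
    (X : measurableType d) (mu : {measure set X -> \bar R}) (f : X -> R[i]) :
    \bar R :=
  Lnorm mu 2%:E (fun x => (ComplexField.Normc.normc (f x))%:E).

Definition L2 (R : realType) (d : measure_display)
    (X : measurableType d) (mu : {measure set X -> \bar R}) :
    set (X -> R[i]) :=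
  [set f | Cmeasurable_fun f /\ (L2norm mu f < +oo)%E].

(** The supremum is taken in [\bar R], so no boundedness of [T] is presupposed;
    it ranges over representatives of the classes in L^2. *)
Definition L2_opnorm (R : realType) (d1 d2 : measure_display)
    (X : measurableType d1) (Y : measurableType d2)
    (mu : {measure set X -> \bar R}) (nu : {measure set Y -> \bar R})
    (T : (X -> R[i]) -> Y -> R[i]) : \bar R :=
  ereal_sup [set L2norm nu (T f) | f in
    [set f : X -> R[i] | L2 mu f /\ (L2norm mu f <= 1)%E]].

Definition Phi (R : realType) (k kP kQ : nat) (x y t : R) : R :=
  x ^+ (k - kP) * t ^+ kP + y ^+ (k - kQ) * t ^+ kQ.

Definition T_op (R : realType) (k kP kQ : nat) (a : R * R * R -> R[i])
    (lambda : R) (f : R -> R[i]) (z : R * R) : R[i] :=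
  Cintegral (@lebesgue_measure R) (fun t =>
    expi (lambda * Phi k kP kQ z.1 z.2 t) * a (z.1, z.2, t) * f t).

Definition rho1 (R : realType) (k kP kQ : nat) : R :=
  1 / (2 * (k%:R - kP%:R)) + 1 / (2 * (k%:R - kQ%:R)).

Definition rho2 (R : realType) (k kP kQ : nat) : R :=
  1 / (2 * (k%:R - kP%:R)) + 1 / (2 * kQ%:R) * (1 - kP%:R / (k%:R - kP%:R)).

Definition rho3 (R : realType) (kP : nat) : R := 1 / (2 * kP%:R).

Definition rho_star (R : realType) (k kP kQ : nat) : R :=
  Num.min (rho1 R k kP kQ) (Num.min (rho2 R k kP kQ) (rho3 R kP)).

(* Main.v *)
(** Test on [f = r^(-1/2) 1_[0,r]], a unit vector of L^2(R).  On the box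
    [[0,X] x [0,Y]] the phase is nearly constant for [t] in [[0,r]] as soon as
    [lambda (X^(k-kP) r^kP + Y^(k-kQ) r^kQ)] is small, so there [|T f|] is at
    least a constant times [r^(1/2)], and the operator norm is at least a
    constant times [(r X Y)^(1/2)].  The choices, up to a small constant,
    - [r = 1], [X = lambda^(-1/(k-kP))], [Y = lambda^(-1/(k-kQ))],
    - [r = lambda^(-1/kQ)], [X = lambda^(-(1-kP/kQ)/(k-kP))], [Y = 1],
    - [r = lambda^(-1/kP)], [X = Y = 1]
    give the exponents [rho1], [rho2] and [rho3]. *)
Require Import Defs.
From mathcomp Require Import all_boot all_order all_algebra.
From mathcomp Require Import all_classical all_reals all_analysis.
From mathcomp Require Import measurable_realfun ring lra.
Import Order.TTheory GRing.Theory Num.Theory.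
Import numFieldNormedType.Exports.
Import ComplexField.Normc.
Local Open Scope ring_scope.

Set Implicit Arguments.
Unset Strict Implicit.
Unset Printing Implicit Defensive.

(** * The L^2 norm: monotonicity and indicator functions *)

(* Holds without measurability because the integral of a nonnegative function
   is a supremum over simple functions below it; this avoids proving that
   [T_op] sends measurable functions to measurable functions. *)
Lemma ge0_le_integralT_nonmeasurable (R : realType) (d : measure_display)
    (X : measurableType d) (mu : {measure set X -> \bar R}) (f g : X -> \bar R) :
  (forall x, (0 <= f x)%E) -> (forall x, (f x <= g x)%E) ->
  (\int[mu]_x f x <= \int[mu]_x g x)%E.
Proof.
move=> f0 fg; rewrite !ge0_integralTE//; last first.
  by move=> x; exact: le_trans (fg x).
apply: ereal_sup_le => _ [h hf <-]; exists h => // x.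
exact: le_trans (fg x).
Qed.

Lemma ge0_le_Lnorm2 (R : realType) (d : measure_display) (X : measurableType d)
    (mu : {measure set X -> \bar R}) (f g : X -> \bar R) :
  (forall x, (0 <= f x)%E) -> (forall x, (f x <= g x)%E) ->
  (Lnorm mu 2%:E f <= Lnorm mu 2%:E g)%E.
Proof.
move=> f0 fg; have g0 x : (0 <= g x)%E by exact: le_trans (fg x).
rewrite unlock; apply: gt0_ler_poweR => //.
- by rewrite in_itv/= leey integral_ge0// => x _; exact: poweR_ge0.
- by rewrite in_itv/= leey integral_ge0// => x _; exact: poweR_ge0.
apply: ge0_le_integralT_nonmeasurable => x; first exact: poweR_ge0.
by apply: gt0_ler_poweR; rewrite // ?in_itv/= ?leey ?abse_ge0 // !gee0_abs.
Qed.

(** Evaluates both the norm of the test function and the norm of the constant lower bound carried by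
    a box. *)
Lemma Lnorm2_indic (R : realType) (d : measure_display) (X : measurableType d)
    (mu : {measure set X -> \bar R}) (B : set X) (c : R) :
  measurable B -> 0 <= c ->
  Lnorm mu 2%:E (fun x => (c * \1_B x)%:E) = (c%:E * mu B `^ 2^-1)%E.
Proof.
move=> mB c0; rewrite unlock.
have -> : (\int[mu]_x (`|(c * \1_B x)%:E| `^ 2))%E = ((c ^+ 2)%:E * mu B)%E.
  rewrite -[B in RHS]setIT -integral_indic//.
  rewrite -ge0_integralZl//; last by rewrite lee_fin sqr_ge0.
    apply: eq_integral => x _.
    rewrite abse_EFin ger0_norm ?mulr_ge0// poweR_EFin powR_mulrn ?mulr_ge0//.
    by rewrite exprMn -EFinM indicE; case: (x \in B);
       rewrite ?expr1n ?expr0n/= ?mulr0 ?mulr1.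
  exact/measurable_EFinP.
rewrite poweRM//; last by rewrite lee_fin sqr_ge0.
by rewrite poweR_EFin powR12_sqrt ?sqr_ge0// sqrtr_sqr ger0_norm.
Qed.

(** * Lower bounds for moduli and for integrals over [[0, r]] *)

Lemma normc_ge_Re (R : realType) (z : R[i]) : `|complex.Re z| <= normc z.
Proof. by case: z => u v /=; rewrite -sqrtr_sqr ler_wsqrtr// lerDl sqr_ge0. Qed.

Lemma normc_ge_Im (R : realType) (z : R[i]) : `|complex.Im z| <= normc z.
Proof. by case: z => u v /=; rewrite -sqrtr_sqr ler_wsqrtr// lerDr sqr_ge0. Qed.

Lemma lebesgue_measure_itv0 (R : realType) (r : R) :
  0 <= r -> lebesgue_measure `[0, r]%classic = r%:E.
Proof.
move=> r0; rewrite lebesgue_measure_itv/= lte_fin.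
case: ltP => [_|r0']; first by rewrite sube0.
by congr EFin; apply: le_anti; rewrite r0 r0'.
Qed.

Lemma Rintegral_itv_ge (R : realType) (h : R -> R) (r c : R) :
  0 <= r -> continuous h -> (forall t, 0 <= t <= r -> c <= h t) ->
  c * r <= Rintegral (@lebesgue_measure R) `[0, r]%classic h.
Proof.
move=> r0 hc ch.
apply: (@le_trans _ _ (Rintegral (@lebesgue_measure R) `[0, r]%classic (cst c))).
  by rewrite Rintegral_cst// [X in _ * fine X]lebesgue_measure_itv0.
apply: le_Rintegral => //.
- apply: continuous_compact_integrable; first exact: segment_compact.
  by apply: continuous_subspaceT => x; exact: cvg_cst.
- apply: continuous_compact_integrable; first exact: segment_compact.
  exact: continuous_subspaceT.
Qed.

(** Staying within [|u| / 2] of [u] makes [h] keep the sign of [u] with size at least [|u| / 2], so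
    the integral has no cancellation. *)
Lemma normr_Rintegral_itv_ge (R : realType) (h : R -> R) (r u : R) :
  0 <= r -> continuous h -> (forall t, 0 <= t <= r -> `|h t - u| <= `|u| / 2) ->
  `|u| / 2 * r <= `|Rintegral (@lebesgue_measure R) `[0, r]%classic h|.
Proof.
move=> r0 hc hu; have [u0|u0] := leP 0 u.
  apply: le_trans (ler_norm _); apply: Rintegral_itv_ge => // t /hu.
  by rewrite (ger0_norm u0) ler_norml => /andP[]; lra.
(* For [u < 0] the same bound is applied to [-h]. *)
rewrite -[leRHS]normrN -mulN1r -RintegralZl//; last first.
  apply: continuous_compact_integrable; first exact: segment_compact.
  exact: continuous_subspaceT.
apply: le_trans (ler_norm _); apply: Rintegral_itv_ge => //.
  by move=> t; apply: cvgMr; exact: hc.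
by move=> t /hu; rewrite (ltr0_norm u0) ler_norml => /andP[]; lra.
Qed.

Lemma Rintegral_indic (R : realType) (d : measure_display)
    (X : measurableType d) (mu : {measure set X -> \bar R}) (A : set X)
    (h : X -> R) :
  Rintegral mu setT (fun t => h t * \1_A t) = Rintegral mu A h.
Proof.
rewrite [RHS]Rintegral_mkcond; congr Rintegral.
apply/funext => t; rewrite indicE patchE.
by case: ifP => /= _; rewrite ?mulr1 ?mulr0.
Qed.

(** * The modulated amplitude near the origin *)

(** The phase value [th] is treated as a fourth variable, independent of the point, so continuity at
    the origin of R^4 suffices and [d] cannot depend on [lambda]. *)
Lemma modulated_amplitude_near0 (R : realType) (a : R * R * R -> R[i]) (e : R) :
  continuous (fun p => complex.Re (a p)) ->
  continuous (fun p => complex.Im (a p)) -> 0 < e ->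
  exists2 d : R, 0 < d & forall x y t th : R,
    `|x| <= d -> `|y| <= d -> `|t| <= d -> `|th| <= d ->
    `|complex.Re (expi th * a (x, y, t)) - complex.Re (a (0, 0, 0))| <= e /\
    `|complex.Im (expi th * a (x, y, t)) - complex.Im (a (0, 0, 0))| <= e.
Proof.
move=> cRe cIm e0.
pose F (q : R * R * R * R) := expi q.2 * a q.1.
have cos_c : continuous (fun q : R * R * R * R => cos q.2).
  by move=> q; apply: continuous_comp; [exact: cvg_snd|exact: continuous_cos].
have sin_c : continuous (fun q : R * R * R * R => sin q.2).
  by move=> q; apply: continuous_comp; [exact: cvg_snd|exact: continuous_sin].
have Re_c : continuous (fun q : R * R * R * R => complex.Re (a q.1)).
  move=> q; apply: (@continuous_comp _ _ _ fst (fun p => complex.Re (a p))).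
    exact: cvg_fst.
  exact: cRe.
have Im_c : continuous (fun q : R * R * R * R => complex.Im (a q.1)).
  move=> q; apply: (@continuous_comp _ _ _ fst (fun p => complex.Im (a p))).
    exact: cvg_fst.
  exact: cIm.
have ReF : (fun q => complex.Re (F q)) =
    fun q => cos q.2 * complex.Re (a q.1) - sin q.2 * complex.Im (a q.1).
  by apply/funext => q; rewrite /F; case: (a q.1).
have ImF : (fun q => complex.Im (F q)) =
    fun q => cos q.2 * complex.Im (a q.1) + sin q.2 * complex.Re (a q.1).
  by apply/funext => q; rewrite /F; case: (a q.1).
have cReF : continuous (fun q => complex.Re (F q)).
  rewrite ReF => q; apply: cvgB; apply: cvgM;
    by [exact: cos_c|exact: sin_c|exact: Re_c|exact: Im_c].
have cImF : continuous (fun q => complex.Im (F q)).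
  rewrite ImF => q; apply: cvgD; apply: cvgM;
    by [exact: cos_c|exact: sin_c|exact: Re_c|exact: Im_c].
have F0 : F (0, 0, 0, 0) = a (0, 0, 0).
  by rewrite /F /expi/= cos0 sin0 mul1r.
have [d d0 dF] : exists2 d : R, 0 < d & forall q, ball (0, 0, 0, 0) d q ->
   `|complex.Re (a (0, 0, 0)) - complex.Re (F q)| < e /\
   `|complex.Im (a (0, 0, 0)) - complex.Im (F q)| < e.
  have /cvgrPdist_lt/(_ e e0) h1 := cReF (0, 0, 0, 0).
  have /cvgrPdist_lt/(_ e e0) h2 := cImF (0, 0, 0, 0).
  have [d /= d0 dh] := (@nbhs_ballP R (R * R * R * R)%type _ _).1 (filterI h1 h2).
  by exists d => // q /dh; rewrite /= F0.
(* Halving [d] puts the points allowed by the non-strict bounds inside the open ball. *)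
exists (d / 2) => [|x y t th xd yd td thd]; first by rewrite divr_gt0.
have dd : d / 2 < d by rewrite ltr_pdivrMr// mulr2n mulrDr mulr1 ltrDl.
have [|h1 h2] := dF (x, y, t, th).
  by rewrite /ball/= /prod_ball/=; do 3?split; rewrite /= /ball/= sub0r normrN;
     exact: le_lt_trans dd.
by rewrite !(distrC _ (_ (a (0,0,0)))); split; exact: ltW.
Qed.

(** * Normalised test functions *)

Definition bump (R : realType) (r : R) (t : R) : R[i] :=
  Complex (r `^ (- 2^-1) * \1_`[0, r]%classic t) 0.

Lemma normc_real (R : realType) (x : R) : normc (Complex x 0) = `|x|.
Proof. by rewrite /normc expr0n addr0 sqrtr_sqr. Qed.

Lemma L2norm_bump (R : realType) (r : R) :
  0 < r -> L2norm (@lebesgue_measure R) (bump r) = 1%E.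
Proof.
move=> r0; rewrite /L2norm.
under [X in Lnorm _ _ X]eq_fun.
  move=> t; rewrite normc_real ger0_norm ?mulr_ge0 ?powR_ge0//. over.
rewrite (Lnorm2_indic (@lebesgue_measure R))// ?powR_ge0//.
rewrite [X in (_ * X `^ _)%E]lebesgue_measure_itv0 ?ltW// poweR_EFin -EFinM.
by rewrite powRN mulVf// gt_eqF// powR_gt0.
Qed.

Lemma L2_bump (R : realType) (r : R) :
  0 < r -> L2 (@lebesgue_measure R) (bump r).
Proof.
move=> r0; split; last by rewrite L2norm_bump// ltry.
by split => //=; apply: measurable_funM.
Qed.

(** * Lower bounds for the operator norm *)

Section lower_bound.
Context {R : realType} (k kP kQ : nat) (a : R * R * R -> R[i]).
Hypothesis Re_a : continuous (fun p => complex.Re (a p)).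
Hypothesis Im_a : continuous (fun p => complex.Im (a p)).

Let amp (lambda x y t : R) : R[i] :=
  expi (lambda * Phi k kP kQ x y t) * a (x, y, t).

Lemma continuous_phase (lambda x y : R) :
  continuous (fun t => lambda * Phi k kP kQ x y t).
Proof.
move=> t; apply: cvgMr; apply: cvgD; apply: cvgMr; exact: exprn_continuous.
Qed.

Lemma continuous_slice (g : R * R * R -> R) (x y : R) :
  continuous g -> continuous (fun t => g (x, y, t)).
Proof.
move=> cg t; apply: (@continuous_comp _ _ _ (fun t => (x, y, t)) g); last exact: cg.
by apply: (@cvg_pair _ _ _ _ (nbhs (x, y)) (nbhs t)); [exact: cvg_cst|exact: cvg_id].
Qed.

Lemma continuous_Re_amp (lambda x y : R) :
  continuous (fun t => complex.Re (amp lambda x y t)).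
Proof.
have -> : (fun t => complex.Re (amp lambda x y t)) = fun t =>
    cos (lambda * Phi k kP kQ x y t) * complex.Re (a (x, y, t)) -
    sin (lambda * Phi k kP kQ x y t) * complex.Im (a (x, y, t)).
  by apply/funext => t; rewrite /amp; case: (a _).
move=> t; apply: cvgB; apply: cvgM.
- apply: (@continuous_comp _ _ _ (fun t => lambda * Phi k kP kQ x y t) (@cos R)).
    exact: continuous_phase.
  exact: continuous_cos.
- exact: (@continuous_slice _ x y Re_a).
- apply: (@continuous_comp _ _ _ (fun t => lambda * Phi k kP kQ x y t) (@sin R)).
    exact: continuous_phase.
  exact: continuous_sin.
- exact: (@continuous_slice _ x y Im_a).
Qed.

Lemma continuous_Im_amp (lambda x y : R) :
  continuous (fun t => complex.Im (amp lambda x y t)).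
Proof.
have -> : (fun t => complex.Im (amp lambda x y t)) = fun t =>
    cos (lambda * Phi k kP kQ x y t) * complex.Im (a (x, y, t)) +
    sin (lambda * Phi k kP kQ x y t) * complex.Re (a (x, y, t)).
  by apply/funext => t; rewrite /amp; case: (a _).
move=> t; apply: cvgD; apply: cvgM.
- apply: (@continuous_comp _ _ _ (fun t => lambda * Phi k kP kQ x y t) (@cos R)).
    exact: continuous_phase.
  exact: continuous_cos.
- exact: (@continuous_slice _ x y Im_a).
- apply: (@continuous_comp _ _ _ (fun t => lambda * Phi k kP kQ x y t) (@sin R)).
    exact: continuous_phase.
  exact: continuous_sin.
- exact: (@continuous_slice _ x y Re_a).
Qed.

(** The real or imaginary part selected by [m] stays close to its value at the origin, so its
    integral over [[0, r]] has size at least [m / 2 * r]; the factor [r^(-1/2)] of [bump r] turns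
    [r] into [r^(1/2)]. *)
Lemma T_op_bump_ge (lambda x y r m : R) :
  0 < r ->
  (forall t, 0 <= t <= r ->
    `|complex.Re (amp lambda x y t) - complex.Re (a (0, 0, 0))| <= m / 2 /\
    `|complex.Im (amp lambda x y t) - complex.Im (a (0, 0, 0))| <= m / 2) ->
  m = `|complex.Re (a (0, 0, 0))| \/ m = `|complex.Im (a (0, 0, 0))| ->
  m / 2 * r `^ 2^-1 <= normc (T_op k kP kQ a lambda (bump r) (x, y)).
Proof.
move=> r0 hm mE.
have r12 : m / 2 * r `^ 2^-1 = r `^ (- 2^-1) * (m / 2 * r).
  have rE : r = r `^ 2^-1 * r `^ 2^-1.
    by rewrite powR12_sqrt ?ltW// -expr2 sqr_sqrtr// ltW.
  have P0 : r `^ 2^-1 != 0 by rewrite gt_eqF// powR_gt0.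
  rewrite powRN; move: (r `^ 2^-1) P0 rE => P P0 ->.
  by field.
have s0 : 0 <= r `^ (- 2^-1) by exact: powR_ge0.
(* The normalising factor is absorbed into both [h] and [u], since the closeness hypothesis scales
   with them. *)
have key (h : R -> R) (u : R) : continuous h ->
    (forall t, 0 <= t <= r -> `|h t - u| <= `|u| / 2) ->
    r `^ (- 2^-1) * (`|u| / 2 * r) <= `|Rintegral (@lebesgue_measure R) setT
      (fun t => (r `^ (- 2^-1) * h t) * \1_`[0, r]%classic t)|.
  move=> ch hu; rewrite Rintegral_indic.
  have -> : r `^ (- 2^-1) * (`|u| / 2 * r) = `|r `^ (- 2^-1) * u| / 2 * r.
    by rewrite normrM (ger0_norm s0) !mulrA.
  apply: normr_Rintegral_itv_ge; first exact: ltW.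
    by move=> t; apply: cvgMr; exact: ch.
  move=> t /hu; rewrite -mulrBr !normrM (ger0_norm s0) -mulrA => ?.
  exact: ler_wpM2l.
(* As [bump r] is real, it multiplies the two parts of [amp] separately. *)
have -> : T_op k kP kQ a lambda (bump r) (x, y) = Complex
    (Rintegral (@lebesgue_measure R) setT (fun t =>
       r `^ (- 2^-1) * complex.Re (amp lambda x y t) * \1_`[0, r]%classic t))
    (Rintegral (@lebesgue_measure R) setT (fun t =>
       r `^ (- 2^-1) * complex.Im (amp lambda x y t) * \1_`[0, r]%classic t)).
  rewrite /T_op /Cintegral; congr Complex; congr Rintegral; apply/funext => t.
    by rewrite -/(amp lambda x y t) /bump; case: (amp _ _ _ _) => u v /=; ring.
  by rewrite -/(amp lambda x y t) /bump; case: (amp _ _ _ _) => u v /=; ring.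
rewrite r12; case: mE => mE; rewrite mE.
  apply: le_trans (normc_ge_Re _); apply: key.
    exact: continuous_Re_amp.
  by move=> t /hm; rewrite mE => -[].
apply: le_trans (normc_ge_Im _); apply: key.
  exact: continuous_Im_amp.
by move=> t /hm; rewrite mE => -[].
Qed.

(** The constants are fixed by [a] before [lambda] and the scales are chosen. Taking the L^2 norm of
    the pointwise bound over the box adds the factor [(X * Y)^(1/2)]. *)
Lemma L2_opnorm_T_op_ge : a (0, 0, 0) != 0 ->
  exists d c : R, [/\ 0 < d, 0 < c &
    forall lambda r X Y : R, 0 <= lambda -> 0 < r <= d -> 0 <= X <= d ->
      0 <= Y <= d ->
      lambda * (X ^+ (k - kP) * r ^+ kP + Y ^+ (k - kQ) * r ^+ kQ) <= d ->
      ((c * (r * X * Y) `^ 2^-1)%:E <=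
        L2_opnorm (@lebesgue_measure R)
          (@lebesgue_measure R \x @lebesgue_measure R)
          (T_op k kP kQ a lambda))%E].
Proof.
move=> a0.
have [m m0 mE] : exists2 m : R, 0 < m &
    m = `|complex.Re (a (0, 0, 0))| \/ m = `|complex.Im (a (0, 0, 0))|.
  move: a0; case: (a (0, 0, 0)) => u v /=; rewrite eq_complex/= negb_and.
  by case/orP => ?; [exists (`|u|) | exists (`|v|)]; rewrite ?normr_gt0//; [left|right].
have m20 : 0 < m / 2 by rewrite divr_gt0.
have [d d0 hd] := modulated_amplitude_near0 Re_a Im_a m20.
exists d, (m / 2); split => //.
move=> lambda r X Y l0 /andP[r0 rd] /andP[X0 Xd] /andP[Y0 Yd] lXY.
apply: ereal_sup_ge; exists (L2norm (@lebesgue_measure R \x @lebesgue_measure R)%E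
   (T_op k kP kQ a lambda (bump r))).
  exists (bump r) => //; split; first exact: L2_bump.
  by rewrite L2norm_bump.
pose B : set (R * R) := (`[0, X] `*` `[0, Y])%classic.
have mB : measurable B by exact: measurableX.
have muB : ((@lebesgue_measure R \x @lebesgue_measure R)%E B = (X * Y)%:E)%E.
  rewrite product_measure1E// EFinM.
  by congr (_ * _)%E; exact: lebesgue_measure_itv0.
have -> : (m / 2 * (r * X * Y) `^ 2^-1)%:E =
   Lnorm (@lebesgue_measure R \x @lebesgue_measure R)%E 2%:E
     (fun z => (m / 2 * r `^ 2^-1 * \1_B z)%:E).
  rewrite (Lnorm2_indic (@lebesgue_measure R \x @lebesgue_measure R)%E)//; last first.
    by rewrite mulr_ge0 ?powR_ge0// divr_ge0// ltW.
  rewrite [X in (_ * X `^ _)%E]muB poweR_EFin -EFinM -!mulrA.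
  by rewrite -powRM ?mulr_ge0// ltW.
apply: ge0_le_Lnorm2 => -[x y].
  by rewrite lee_fin !mulr_ge0 ?powR_ge0// ltW.
(* Off the box the comparison function vanishes, so only points of the box need the phase
   estimate. *)
rewrite lee_fin indicE; case: (boolP ((x, y) \in B)) => [|_]; last first.
  by rewrite mulr0; case: (T_op _ _ _ _ _ _ _) => u v; exact: sqrtr_ge0.
rewrite inE => -[/=]; rewrite !in_itv/= => /andP[x0 xX] /andP[y0 yY].
rewrite mulr1; apply: T_op_bump_ge => // t /andP[t0 tr].
apply: hd; rewrite ger0_norm//.
- exact: le_trans Xd.
- exact: le_trans Yd.
- exact: le_trans rd.
(* All variables are nonnegative here, so the phase is largest at the corner [(X, Y, r)]. *)
- apply: le_trans lXY; apply: ler_wpM2l => //.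
  by apply: lerD; apply: ler_pM; rewrite ?exprn_ge0// lerXn2r// nnegrE//
     (le_trans _ xX, le_trans _ yY, le_trans _ tr).
- by rewrite mulr_ge0// addr_ge0// mulr_ge0// exprn_ge0.
Qed.

(** The scales are [lambda^(-al)], [lambda^(-be)], [lambda^(-ga)] for [r], [X], [Y], each times a
    small fixed [e]. The two linear inequalities say that [lambda] times either phase monomial
    carries a nonpositive power of [lambda]. *)
Lemma L2_opnorm_T_op_powR (al be ga : R) :
  (0 < k)%N -> (kP <= k)%N -> (kQ <= k)%N -> 0 <= al -> 0 <= be -> 0 <= ga ->
  1 <= (k%:R - kP%:R) * be + kP%:R * al ->
  1 <= (k%:R - kQ%:R) * ga + kQ%:R * al ->
  a (0, 0, 0) != 0 ->
  exists2 c : R, 0 < c & forall lambda : R, 1 <= lambda ->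
    ((c * lambda `^ (- ((al + be + ga) / 2)))%:E <=
      L2_opnorm (@lebesgue_measure R)
        (@lebesgue_measure R \x @lebesgue_measure R)
        (T_op k kP kQ a lambda))%E.
Proof.
move=> k0 kPk kQk al0 be0 ga0 hP hQ /L2_opnorm_T_op_ge[d [c [d0 c0 hd]]].
(* As [e <= 1] and [0 < k], also [e ^+ k <= d / 2]: each of the two phase terms may use half of the
   allowance [d]. *)
pose e := Num.min 1 (d / 2).
have e0 : 0 < e by rewrite lt_min ltr01 divr_gt0.
have e1 : e <= 1 by rewrite ge_min lexx.
have ed2 : e <= d / 2 by rewrite ge_min lexx orbT.
have ek : e ^+ k <= d / 2.
  by apply: le_trans ed2; rewrite -[leRHS]expr1 ler_wiXn2l// ltW.
(* One factor [e] comes from each of [r], [X] and [Y]. *)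
exists (c * (e ^+ 3) `^ 2^-1) => [|lambda l1].
  by rewrite mulr_gt0// powR_gt0// exprn_gt0.
have l0 : 0 < lambda by exact: lt_le_trans l1.
have lpos (s : R) : 0 < lambda `^ s by exact: powR_gt0.
have powD (s t : R) : lambda `^ (s + t) = lambda `^ s * lambda `^ t.
  by rewrite powRD// (gt_eqF l0) implybT.
have scaled (s : R) : 0 <= s -> 0 < e * lambda `^ (- s) <= d.
  move=> s0; rewrite mulr_gt0//=.
  have ls1 : lambda `^ (- s) <= 1.
    by rewrite -(powRr0 lambda) ler_powR// oppr_le0.
  apply: (@le_trans _ _ e); first by rewrite ler_piMr// ltW.
  by apply: le_trans ed2 _; rewrite ler_pdivrMr// mulr2n mulrDr mulr1 lerDl ltW.
have monomial (s : R) (j : nat) : (j <= k)%N ->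
    1 <= (k%:R - j%:R) * s + j%:R * al ->
    lambda * ((e * lambda `^ (- s)) ^+ (k - j) * (e * lambda `^ (- al)) ^+ j)
      <= d / 2.
  move=> jk hs; apply: le_trans ek.
  have powE (u : R) (n : nat) : (lambda `^ u) ^+ n = lambda `^ (u * n%:R).
    by rewrite powRrM powR_mulrn// ltW.
  (* The degrees [k - j] and [j] add up to [k], so the constant is [e ^+ k] whatever [j] is; the
     remaining power of [lambda] is at most 1. *)
  rewrite !exprMn mulrACA -exprD subnK// [leLHS]mulrCA ler_piMr ?exprn_ge0 ?(ltW e0)//.
  rewrite !powE -powD -[X in X * _]powRr1 ?(ltW l0)// -powD.
  by rewrite -[leRHS](powRr0 lambda) ler_powR// natrB//; lra.
have /andP[r0 rd] := scaled _ al0.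
have /andP[X0 Xd] := scaled _ be0.
have /andP[Y0 Yd] := scaled _ ga0.
have -> : c * (e ^+ 3) `^ 2^-1 * lambda `^ (- ((al + be + ga) / 2)) =
    c * (e * lambda `^ (- al) * (e * lambda `^ (- be)) * (e * lambda `^ (- ga))) `^ 2^-1.
  have -> : e * lambda `^ (- al) * (e * lambda `^ (- be)) * (e * lambda `^ (- ga))
      = e ^+ 3 * lambda `^ (- (al + be + ga)).
    have -> : - (al + be + ga) = - al + (- be) + (- ga) by ring.
    by rewrite !powD; ring.
  rewrite [in RHS]powRM ?exprn_ge0 ?(ltW e0) ?(ltW (lpos _))// -powRrM mulrA.
  by congr (_ * _ `^ _); ring.
apply: hd; rewrite ?r0 ?(ltW l0) ?(ltW X0) ?(ltW Y0)//.
rewrite mulrDr [leRHS](splitr d).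
by apply: lerD; exact: monomial.
Qed.

End lower_bound.

(** * The three choices of exponents *)

Theorem theorem1p5 (R : realType) (k kP kQ : nat)
    (hk : (3 <= k)%N) (hP : (1 <= kP)%N) (hPQ : (kP < kQ)%N) (hQ : (kQ < k)%N)
    (a : R * R * R -> complex R)
    (ha : Cc_infty3 a) (hsupp : (supp3 a `<=` @cube3 R)%classic)
    (ha0 : a (0, 0, 0) != 0) :
  exists c lambda1 : R, [/\ 0 < c, 2 <= lambda1 &
    forall lambda : R, lambda1 <= lambda ->
      ((c * lambda `^ (- rho_star R k kP kQ))%:E <=
         L2_opnorm (@lebesgue_measure R)
           (@lebesgue_measure R \x @lebesgue_measure R)
           (T_op k kP kQ a lambda))%E].
Proof.
(* The empty list of partial derivatives yields continuity of both parts of [a]. *)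
have [/(_ [::])[Re_a _] /(_ [::])[Im_a _] _] := ha.
have p0 : 0 < kP%:R :> R by rewrite ltr0n.
have pq : kP%:R < kQ%:R :> R by rewrite ltr_nat.
have qk : kQ%:R < k%:R :> R by rewrite ltr_nat.
have q0 : 0 < kQ%:R :> R by exact: lt_trans pq.
have kp0 : 0 < k%:R - kP%:R :> R by rewrite subr_gt0 (lt_trans pq).
have kq0 : 0 < k%:R - kQ%:R :> R by rewrite subr_gt0.
have kPk : (kP <= k)%N by rewrite ltnW// (ltn_trans hPQ).
have bound := L2_opnorm_T_op_powR Re_a Im_a (leq_trans (isT : 0 < 3)%N hk) kPk (ltnW hQ).
(* The minimum equals one of the three exponents, so admissible scales may be chosen separately in
   each case. *)
suff [al [be [ga [[al0 be0 ga0] [h1 h2 h3]]]]] : exists al be ga : R,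
    [/\ 0 <= al, 0 <= be & 0 <= ga] /\
    [/\ 1 <= (k%:R - kP%:R) * be + kP%:R * al,
        1 <= (k%:R - kQ%:R) * ga + kQ%:R * al &
        rho_star R k kP kQ = (al + be + ga) / 2].
  have [c c0 hc] := bound al be ga al0 be0 ga0 h1 h2 ha0.
  exists c, 2; split => // lambda l2; rewrite h3; apply: hc.
  by apply: le_trans l2; rewrite ler1n.
have [kp_n0 [kq_n0 [p_n0 q_n0]]] : k%:R - kP%:R != 0 :> R /\ k%:R - kQ%:R != 0 :> R /\
    kP%:R != 0 :> R /\ kQ%:R != 0 :> R by rewrite !gt_eqF.
have : [\/ rho_star R k kP kQ = rho1 R k kP kQ, rho_star R k kP kQ = rho2 R k kP kQ |
    rho_star R k kP kQ = rho3 R kP].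
  rewrite /rho_star; set x := rho1 _ _ _ _; set y := rho2 _ _ _ _; set z := rho3 _ _.
  case: (leP x (Num.min y z)) => _; first by constructor 1.
  by case: (leP y z) => _; [constructor 2|constructor 3].
case=> ->.
(* The interval length does not shrink with [lambda]; both constraints are equalities. *)
- exists 0, (k%:R - kP%:R)^-1, (k%:R - kQ%:R)^-1; split.
    by split; rewrite // invr_ge0 ltW.
  split; rewrite ?mulfV// ?mulr0 ?addr0//.
  by rewrite /rho1; field; rewrite ?kp_n0 ?kq_n0 ?q_n0.
(* With [ga = 0], the second constraint fixes [al]; then [be] solves the first with equality, and is
   nonnegative because [kP < kQ]. *)
- exists kQ%:R^-1, ((1 - kP%:R / kQ%:R) / (k%:R - kP%:R)), 0; split.
    split; rewrite // ?invr_ge0 ?(ltW q0)//.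
    apply: divr_ge0; last exact: ltW.
    by rewrite subr_ge0 ler_pdivrMr // mul1r ltW.
  split.
  + by rewrite mulrC divfK// subrK.
  + by rewrite mulr0 add0r mulfV.
  + by rewrite /rho2; field; rewrite ?kp_n0 ?kq_n0 ?q_n0.
(* Only [r] shrinks: the first constraint is an equality and the second reads [kQ / kP >= 1]. *)
- exists kP%:R^-1, 0, 0; split; first by split; rewrite // invr_ge0 ltW.
  split; rewrite ?mulr0 ?add0r ?addr0.
  + by rewrite mulfV.
  + by rewrite ler_pdivlMr// mul1r ltW.
  + by rewrite /rho3; field.
Qed.
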